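(* Let $X$ be a real superreflexive Banach space with an equivalent norm $\|\cdot\|$, $0<\alpha\le1$ and $C\ge2$ such that $$\|x+h\|^{1+\alpha}+\|x-h\|^{1+\alpha}-2\|x\|^{1+\alpha}\le C\|h\|^{1+\alpha}\quad\text{for all }x,h\in X.$$ Let $E\subset X$ be a nonempty subset, $f:E\to\mathbb{R}$, $G:E\to X^*$ functions, and $M>0$. Suppose that $(f,G)$ satisfies property $(CW^{1,\alpha})$ with constant $M$ on $E$, that is, $$f(x)\ge f(y)+G(y)(x-y)+\frac{\alpha}{(1+\alpha)M^{1/\alpha}}\|G(x)-G(y)\|_*^{1+\frac1\alpha}\quad\text{for all }x,y\in E.$$ Then the formula $$F=\mathrm{conv}(g),\qquad g(x)=\inf_{y\in E}\Big\{f(y)+G(y)(x-y)+\tfrac{M}{1+\alpha}\|x-y\|^{1+\alpha}\Big\},\quad x\in X,$$ defines a $C^{1,\alpha}$ convex function $F:X\to\mathbb{R}$ with $F|_E=f$, $(DF)|_E=G$, and $$M_\alpha(DF)\le\frac{2^{1+\alpha}C}{1+\alpha}M.$$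
   Context: $\|\cdot\|_*$ is the norm on $X^*$ dual to $\|\cdot\|$. For a map $G:E\to X^*$ with $E\subset X$, $M_\alpha(G)=\sup_{x\ne y,\ x,y\in E}\frac{\|G(x)-G(y)\|_*}{\|x-y\|^\alpha}$. $F:X\to\mathbb{R}$ is of class $C^{1,\alpha}$ if it is Fréchet differentiable and $M_\alpha(DF)<\infty$. For $g:X\to\mathbb{R}$, the convex envelope is $\mathrm{conv}(g)(x)=\sup\{\phi(x):\phi\text{ is convex, proper and lower semicontinuous on }X,\ \phi\le g\}$. (By Pisier's renorming theorem every superreflexive Banach space has an equivalent norm satisfying the first displayed inequality for some $0<\alpha\le1$ and $C\ge2$.) *)

(* Defs.v *)
From HB Require Import structures.
From mathcomp Require Import all_boot all_order all_algebra.
From mathcomp Require Import all_classical all_reals all_analysis.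

Set Implicit Arguments.
Unset Strict Implicit.
Unset Printing Implicit Defensive.

Import Order.TTheory GRing.Theory Num.Theory.
Import numFieldNormedType.Exports.

Local Open Scope classical_set_scope.
Local Open Scope ring_scope.

(* The topological dual is a set of functions; sums and scalar multiples of
   functionals are the pointwise ones on X -> R. *)
Definition dual (R : realType) (X : normedModType R) : set (X -> R) :=
  [set l | (forall (a : R) (x y : X), l (a *: x + y) = a * l x + l y)
           /\ continuous l].
Arguments dual {R} X _.

Definition is_norm (R : realType) (X : lmodType R) (N : X -> R) : Prop :=
  [/\ forall x y, N (x + y) <= N x + N y,
      forall (a : R) x, N (a *: x) = `|a| * N x
    & forall x, N x = 0 -> x = 0].

Definition equivalent_norm (R : realType) (X : normedModType R) (N : X -> R) :
    Prop :=
  is_norm N /\ exists a b : R,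
    [/\ 0 < a, 0 < b & forall x, a * `|x| <= N x /\ N x <= b * `|x|].

(* The supremum is taken in R, hence it is only meaningful when l is bounded on
   the unit ball of N; this holds if l \in dual X and N is an equivalent norm. *)
Definition dual_norm (R : realType) (X : normedModType R) (N : X -> R)
    (l : X -> R) : R :=
  sup [set `|l h| | h in [set h | N h <= 1]].

(* Every bounded linear functional Phi on the dual of Y is evaluation at a point
   of Y.  Phi is a total function, but only its values on dual Y matter. *)
Definition reflexive_space (R : realType) (Y : normedModType R) : Prop :=
  forall Phi : (Y -> R) -> R,
    (forall (a : R) (l m : Y -> R), dual Y l -> dual Y m ->
       Phi (fun y => a * l y + m y) = a * Phi l + Phi m) ->
    (exists K : R, forall l : Y -> R, dual Y l ->
       `|Phi l| <= K * dual_norm (fun y : Y => `|y|) l) ->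
    exists y : Y, forall l : Y -> R, dual Y l -> Phi l = l y.

Definition finite_dim_subspace (R : realType) (Y : lmodType R) (L : set Y) :
    Prop :=
  exists (n : nat) (b : 'I_n -> Y),
    L = [set y | exists c : 'I_n -> R, y = \sum_(i < n) c i *: b i].

(* Every finite-dimensional subspace L of Y is (1 + e)-isomorphic, for all
   e > 0, to a subspace of X: the isomorphism T : L -> T(L), rescaled so that
   its inverse has norm at most 1, is a function on Y of which only the
   restriction to L matters. *)
Definition finitely_representable (R : realType) (Y X : normedModType R) :
    Prop :=
  forall (L : set Y) (e : R), finite_dim_subspace L -> 0 < e ->
    exists T : Y -> X,
      (forall (a : R) (y z : Y), L y -> L z -> T (a *: y + z) = a *: T y + T z)
      /\ (forall y, L y -> `|y| <= `|T y| /\ `|T y| <= (1 + e) * `|y|).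

Definition superreflexive (R : realType) (X : normedModType R) : Prop :=
  forall Y : completeNormedModType R,
    finitely_representable Y X -> reflexive_space Y.

(* The supremum over an empty set of pairs (E with at most one point) is -oo. *)
Definition holder_const (R : realType) (X : normedModType R) (N : X -> R)
    (alpha : R) (E : set X) (G : X -> X -> R) : \bar R :=
  ereal_sup [set (dual_norm N (fun h => G p.1 h - G p.2 h)
                  / N (p.1 - p.2) `^ alpha)%:E
            | p in [set p : X * X | [/\ E p.1, E p.2 & p.1 <> p.2]]].

Definition class_C1 (R : realType) (X : normedModType R) (N : X -> R)
    (alpha : R) (F : X -> R) : Prop :=
  (forall x, differentiable F x)
  /\ (holder_const N alpha setT (fun x => 'd F x : X -> R) < +oo)%E.

Definition CW (R : realType) (X : normedModType R) (N : X -> R) (alpha M : R)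
    (E : set X) (f : X -> R) (G : X -> X -> R) : Prop :=
  forall x y, E x -> E y ->
    f y + G y (x - y)
      + alpha / ((1 + alpha) * M `^ alpha^-1)
        * dual_norm N (fun h => G x h - G y h) `^ (1 + alpha^-1)
    <= f x.

Definition convex_ereal (R : realType) (X : lmodType R) (phi : X -> \bar R) :
    Prop :=
  forall (x y : X) (t : R), 0 <= t -> t <= 1 ->
    (phi (t *: x + (1 - t) *: y)%R
      <= t%:E * phi x + (1 - t)%:E * phi y)%E.

Definition proper (R : realType) (X : Type) (phi : X -> \bar R) : Prop :=
  (forall x, -oo < phi x)%E /\ exists x, (phi x < +oo)%E.

Definition conv_env (R : realType) (X : normedModType R) (g : X -> R) (x : X) :
    \bar R :=
  ereal_sup [set phi x | phi in [set phi : X -> \bar R |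
    [/\ convex_ereal phi, proper phi, lower_semicontinuous phi
      & forall z, (phi z <= (g z)%:E)%E]]].

(* Main.v *)
Require Import Defs.
From HB Require Import structures.
From mathcomp Require Import all_boot all_order all_algebra.
From mathcomp Require Import all_classical all_reals all_analysis.
From mathcomp Require Import ring lra.

Set Implicit Arguments.
Unset Strict Implicit.
Unset Printing Implicit Defensive.

Import Order.TTheory GRing.Theory Num.Theory.
Import numFieldNormedType.Exports.

Local Open Scope classical_set_scope.
Local Open Scope ring_scope.

(** Write [p = 1 + alpha] and [c = C * M / p].  For [z] in [E] let the tangent
    at [z] be [x |-> f z + G z (x - z)], and for [y] in [E] let the growth bound
    at [y] be the tangent at [y] plus [M / p * N (x - y) ^ p], so that [g] is
    the infimum of the growth bounds.

    Condition [CW] is exactly what Young's inequality needs for every tangent to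
    lie below every growth bound ([CW_tangent_le_jet_bound]).  Hence [g] is
    finite and the tangents, being convex and continuous, lie below
    [F = conv g]: the envelope is sandwiched between the tangent and the growth
    bound at any point of [E], which gives [F = f] on [E] and, the two bounds
    agreeing to first order, [DF = G] there.

    By smoothness of the norm, the second differences
    [N (x + h) ^ p + N (x - h) ^ p - 2 * N x ^ p] are at most [C * N h ^ p].
    This passes to the growth bounds, and to their infimum, as
    [g (x + h) + g (x - h) - 2 * g x <= c * N h ^ p].  It passes to the envelope
    too ([envelope_second_difference]): for fixed [h], the function
    [x |-> (F (x + h) + F (x - h) - c * N h ^ p) / 2] is convex, continuous and
    below [g], hence below [F], the largest such function.

    A convex function with this property has a gradient [L] everywhere
    ([convexf_gradient]): its one-sided directional derivative is sublinear, and
    the bound on second differences makes it odd, since [p > 1].  The same bound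
    gives [0 <= F (x + h) - F x - L h <= c * N h ^ p], and comparing these
    expansions at two points yields the Hoelder constant [2 * c]
    ([gradient_holder]), which is at most [2 ^ p * c]. *)

(** * Powers with exponent greater than one *)

Section Powers.
Context {R : realType}.
Implicit Types (alpha t : R).

Lemma powR_1D alpha t : 0 <= alpha -> 0 <= t ->
  t `^ (1 + alpha) = t * t `^ alpha.
Proof.
move=> alpha0 t0; rewrite powRD ?powRr1//.
by apply/implyP => /eqP e; exfalso; lra.
Qed.

(** The bound holds on a whole interval [0, t0], so that it serves both at one
    small scale and as a little-o estimate. *)
Lemma powR_superlinear alpha (K e : R) : 0 < alpha -> 0 <= K -> 0 < e ->
  exists2 t0 : R, 0 < t0 &
    forall t, 0 <= t -> t <= t0 -> K * t `^ (1 + alpha) <= e * t.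
Proof.
move=> alpha0 K0 e0; exists ((e / (K + 1)) `^ alpha^-1).
  by apply: powR_gt0; apply: divr_gt0 => //; lra.
move=> t t0 tle; rewrite powR_1D ?(ltW alpha0)//.
have K1 : 0 < K + 1 by lra.
have : t `^ alpha <= e / (K + 1).
  apply: (le_trans (ge0_ler_powR (ltW alpha0) _ _ tle)).
  - by rewrite nnegrE.
  - by rewrite nnegrE powR_ge0.
  - by rewrite -powRrM mulVf ?gt_eqF// powRr1// divr_ge0// ltW.
rewrite ler_pdivlMr// => h.
have := powR_ge0 t alpha; move: (t `^ alpha) h => s h s0.
by rewrite mulrCA [leRHS]mulrC ler_wpM2l//; lra.
Qed.

(** Young's inequality for the conjugate exponents [1 + alpha^-1] and
    [1 + alpha]; the weight [M] makes the two constants those of [CW] and of the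
    growth term of [g]. *)
Lemma young_weighted alpha (M a b : R) : 0 < alpha -> 0 < M -> 0 <= a ->
  0 <= b ->
  a * b <= alpha / ((1 + alpha) * M `^ alpha^-1) * a `^ (1 + alpha^-1)
           + M / (1 + alpha) * b `^ (1 + alpha).
Proof.
move=> alpha0 M0 a0 b0.
have p0 : 0 < 1 + alpha by lra.
have ia0 : 0 < alpha^-1 by rewrite invr_gt0.
have q0 : 0 < 1 + alpha^-1 by lra.
have m0 : 0 < M `^ (1 + alpha)^-1 by apply: powR_gt0.
have conj : (1 + alpha^-1)^-1 + (1 + alpha)^-1 = 1.
  by field; rewrite !gt_eqF//; lra.
(* Scaling the factors by M ^ (1 / (1 + alpha)) and its inverse leaves the
   product unchanged and gives b ^ (1 + alpha) the coefficient M. *)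
have := @conjugate_powR _ (a / M `^ (1 + alpha)^-1) (M `^ (1 + alpha)^-1 * b)
  _ _ (divr_ge0 a0 (ltW m0)) (mulr_ge0 (ltW m0) b0) q0 p0 conj.
rewrite mulrA divfK ?gt_eqF//; move/le_trans; apply.
rewrite !powRM ?invr_ge0// ?(ltW m0)//.
rewrite -powRN -!powRrM mulVf ?gt_eqF// powRr1 ?(ltW M0)//.
have -> : - (1 + alpha)^-1 * (1 + alpha^-1) = - alpha^-1.
  by field; rewrite !gt_eqF//; lra.
rewrite powRN.
have Ma : M `^ alpha^-1 != 0 by rewrite gt_eqF// powR_gt0.
rewrite le_eqVlt; apply/orP; left; apply/eqP.
by field; rewrite Ma !gt_eqF//; lra.
Qed.

End Powers.

(** * Equivalent norms and their dual norms *)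

Section EquivalentNorm.
Context {R : realType} {X : normedModType R} {N : X -> R}.
Hypothesis hN : equivalent_norm N.

Lemma eqnormD x y : N (x + y) <= N x + N y.
Proof. by have [[]] := hN. Qed.

Lemma eqnormZ (a : R) x : N (a *: x) = `|a| * N x.
Proof. by have [[]] := hN. Qed.

Lemma eqnorm0 : N 0 = 0.
Proof. by rewrite -[X in N X](scale0r (0 : X)) eqnormZ normr0 mul0r. Qed.

Lemma eqnormN x : N (- x) = N x.
Proof. by rewrite -scaleN1r eqnormZ normrN1 mul1r. Qed.

Lemma eqnorm_ge0 x : 0 <= N x.
Proof. by have := eqnormD x (- x); rewrite subrr eqnorm0 eqnormN; lra. Qed.

Lemma eqnorm_eq0 x : N x = 0 -> x = 0.
Proof. by have [[_ _ h0] _] := hN; exact: h0. Qed.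

Lemma eqnorm_lt_near (e : R) : 0 < e -> \forall h \near (0 : X), N h < e.
Proof.
move=> e0; have [_ [a [b [a0 b0 ab]]]] := hN.
near=> h; apply: (le_lt_trans (ab h).2).
rewrite mulrC -ltr_pdivlMr//.
by near: h; apply: cvgr0_norm_lt => //; apply: divr_gt0.
Unshelve. all: by end_near. Qed.

Lemma near_eqnorm (x : X) (e : R) (P : set X) : 0 < e ->
  (forall h, N h < e -> P (x + h)) -> nbhs x P.
Proof.
move=> e0 hP; apply/nbhs0P.
near=> h; apply: hP; near: h; exact: eqnorm_lt_near.
Unshelve. all: by end_near. Qed.

Lemma continuous_eqnorm (F : X -> R) (x : X) (K : R) :
  (forall h, N h <= 1 -> `|F (x + h) - F x| <= K * N h) ->
  {for x, continuous F}.
Proof.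
move=> hF; apply/(@cvgrPdist_lt _ R^o) => e e0.
have K0 : 0 < `|K| + 1 by rewrite ltr_pwDr.
apply: (@near_eqnorm x (Num.min 1 (e / (`|K| + 1)))).
  by rewrite lt_min ltr01 divr_gt0.
move=> h; rewrite lt_min => /andP[h1 he] /=.
rewrite distrC; apply: (le_lt_trans (hF _ (ltW h1))).
move: he; rewrite ltr_pdivlMr// => he.
have := eqnorm_ge0 h; have := ler_norm K; nra.
Qed.

(** Bundles a functional as a linear map, so that the theory of linear maps
    applies to it. *)
Lemma dual_pack (l : X -> R) : dual X l ->
  exists L : {linear X -> R^o}, (L : X -> R) = l.
Proof.
move=> [llin _].
pose lL := GRing.isLinear.Build R X R^o *:%R l llin.
by exists (HB.pack_for {linear X -> R^o} (l : X -> R^o) lL).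
Qed.

Lemma dual_bounded (l : X -> R) : dual X l ->
  exists2 K, 0 <= K & forall h, `|l h| <= K * N h.
Proof.
move=> dl; have [L Ll] := dual_pack dl.
have [_ [a [b [a0 b0 ab]]]] := hN.
have [k k0 hk] : exists2 k, k > 0 & forall x, `|L x| <= k * `|x|.
  by apply: linear_lipschitz; rewrite Ll; exact: dl.2.
exists (k / a) => [|h]; first by rewrite divr_ge0 ?ltW.
rewrite -Ll; apply: (le_trans (hk h)).
rewrite -mulrA ler_pM2l// mulrC ler_pdivlMr// mulrC.
exact: (ab h).1.
Qed.

Lemma dualB (l m : X -> R) : dual X l -> dual X m ->
  dual X (fun h => l h - m h).
Proof.
move=> [ll lc] [ml mc]; split=> [a x y|x]; first by rewrite ll ml; ring.
by apply: (@cvgB _ R^o); [exact: lc|exact: mc].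
Qed.

(** [dual_norm] is a supremum of reals, so this needs the boundedness of [l] on
    the unit ball, which continuity provides. *)
Lemma dual_eqnorm_le (l : X -> R) (h : X) : dual X l ->
  `|l h| <= dual_norm N l * N h.
Proof.
move=> dl; have [L Ll] := dual_pack dl; have [K K0 hK] := dual_bounded dl.
have [->|h0] := eqVneq h 0.
  by rewrite eqnorm0 mulr0 -Ll linear0 normr0.
have Nh0 : 0 < N h.
  rewrite lt_neqAle eqnorm_ge0 andbT; apply: contra_neq h0 => /esym.
  exact: eqnorm_eq0.
rewrite -ler_pdivrMr//; apply: ub_le_sup.
  exists K => _ [k /= k1 <-]; apply: (le_trans (hK k)).
  by rewrite -[leRHS]mulr1 ler_wpM2l.
exists ((N h)^-1 *: h) => /=.
  by rewrite eqnormZ gtr0_norm ?invr_gt0// mulVf// gt_eqF.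
rewrite -Ll linearZ /= normrM gtr0_norm ?invr_gt0//.
by rewrite mulrC.
Qed.

Lemma dual_norm_le (l : X -> R) (K : R) :
  (forall h, N h <= 1 -> `|l h| <= K) -> dual_norm N l <= K.
Proof.
move=> hK; apply: ge_sup; last by move=> _ [h /= h1 <-]; exact: hK.
by exists `|l 0|, 0; rewrite //= eqnorm0.
Qed.

Lemma dual_norm_ge0 (l : X -> R) : dual X l -> 0 <= dual_norm N l.
Proof.
move=> dl; have [K K0 hK] := dual_bounded dl.
apply: (le_trans (normr_ge0 (l 0))); apply: ub_le_sup.
  exists K => _ [k /= k1 <-]; apply: (le_trans (hK k)).
  by rewrite -[leRHS]mulr1 ler_wpM2l.
by exists 0; rewrite //= eqnorm0.
Qed.

End EquivalentNorm.

(** * Differentiability of convex functions with small second differences *)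

Definition convexf (R : realType) (X : lmodType R) (F : X -> R) : Prop :=
  forall (x y : X) (t : R), 0 <= t -> t <= 1 ->
    F (t *: x + (1 - t) *: y) <= t * F x + (1 - t) * F y.

Lemma convex_comb_shift (R : realType) (X : lmodType R) (u v k : X) (t : R) :
  t *: u + (1 - t) *: v + k = t *: (u + k) + (1 - t) *: (v + k).
Proof.
by rewrite !scalerDr addrACA -scalerDl [t + (1 - t)]addrC subrK scale1r.
Qed.

(** Convexity seen from a base point: in the applications the combination of the
    increments is computed first, often to [0] so as to recover [F x]. *)
Lemma convexf_at (R : realType) (X : lmodType R) (F : X -> R) (x h k : X)
    (t : R) : convexf F -> 0 <= t -> t <= 1 ->
  F (x + (t *: h + (1 - t) *: k)) <= t * F (x + h) + (1 - t) * F (x + k).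
Proof.
move=> cF t0 t1; have := cF (h + x) (k + x) t t0 t1.
by rewrite -convex_comb_shift !(addrC x).
Qed.

Section ConvexRegularity.
Context {R : realType} {X : normedModType R} {N : X -> R}.
Hypothesis hN : equivalent_norm N.

(** Let [t = N k] and let [h = k / t] be the unit vector along [k].  The upper
    bound comes from writing [x + k] between [x] and [x + h], the lower bound
    from writing [x] between [x + k] and [x - h]. *)
Lemma convexf_ball_lipschitz (F : X -> R) (x k : X) (B : R) : convexf F ->
  (forall h, N h <= 1 -> F (x + h) <= B) -> N k <= 1 ->
  `|F (x + k) - F x| <= (B - F x) * N k.
Proof.
move=> cF hB k1.
have [->|k0] := eqVneq k 0.
  by rewrite addr0 subrr normr0 eqnorm0// mulr0.
have [t tE] : exists t, t = N k by exists (N k).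
have t0 : 0 < t.
  rewrite tE lt_neqAle eqnorm_ge0// andbT; apply: contra_neq k0 => /esym.
  exact: (eqnorm_eq0 hN).
have t1 : t <= 1 by rewrite tE.
have Nh : N (t^-1 *: k) = 1.
  by rewrite eqnormZ// gtr0_norm ?invr_gt0// -tE mulVf// gt_eqF.
have up := @convexf_at _ _ F x (t^-1 *: k) 0 t cF (ltW t0) t1.
have s0 : 0 <= (1 + t)^-1 by rewrite invr_ge0; lra.
have s1 : (1 + t)^-1 <= 1 by rewrite invf_le1; lra.
have lo := @convexf_at _ _ F x k (- (t^-1 *: k)) _ cF s0 s1.
have := hB (t^-1 *: k); have := hB (- (t^-1 *: k)).
rewrite eqnormN// Nh => /(_ (lexx _)) B1 /(_ (lexx _)) B2.
move: up; rewrite scaler0 !addr0 scalerA mulfV ?gt_eqF// scale1r => up.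
have e0 : (1 + t)^-1 *: k + (1 - (1 + t)^-1) *: (- (t^-1 *: k)) = 0.
  rewrite scalerN scalerA -scalerBl; apply/eqP; rewrite scaler_eq0.
  by apply/orP; left; apply/eqP; field; rewrite !gt_eqF//; lra.
move: lo; rewrite e0 addr0 => lo.
have {}lo : (1 + t) * F x <= F (x + k) + t * F (x - t^-1 *: k).
  have t10 : 0 < 1 + t by lra.
  apply: (le_trans (ler_wpM2l (ltW t10) lo)).
  rewrite le_eqVlt; apply/orP; left; apply/eqP.
  by field; rewrite gt_eqF.
rewrite -tE ler_norml; apply/andP; split; nra.
Qed.

Lemma convexf_continuous (F : X -> R) : convexf F ->
  (forall x, exists B, forall h, N h <= 1 -> F (x + h) <= B) -> continuous F.
Proof.
move=> cF hB x; have [B hx] := hB x.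
apply: (continuous_eqnorm hN (K := B - F x)) => h h1.
exact: convexf_ball_lipschitz.
Qed.

Section Gradient.
Variables (F : X -> R) (x : X) (alpha c : R).
Hypotheses (cF : convexf F) (alpha0 : 0 < alpha) (c0 : 0 <= c).
Hypothesis F2 : forall h,
  F (x + h) + F (x - h) - 2 * F x <= c * N h `^ (1 + alpha).

(** Convexity makes [q] nondecreasing in [t], so that the infimum [D] is the
    one-sided directional derivative of [F] at [x].  As an infimum, it is
    bounded above by the value of [q] at any single scale. *)
Let q (t : R) (h : X) : R := (F (x + t *: h) - F x) / t.
Let D (h : X) : R := inf [set q t h | t in [set t | 0 < t]].

(** Write [x] as a convex combination of [x + t *: h] and [x - h]. *)
Let q_ge t h : 0 < t -> F x - F (x - h) <= q t h.
Proof.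
move=> t0; rewrite /q ler_pdivlMr//.
have t10 : 0 < 1 + t by lra.
have s0 : 0 <= (1 + t)^-1 by rewrite invr_ge0; lra.
have s1 : (1 + t)^-1 <= 1 by rewrite invf_le1; lra.
have := @convexf_at _ _ F x (t *: h) (- h) _ cF s0 s1.
rewrite scalerN scalerA -scalerBl.
have -> : (1 + t)^-1 * t - (1 - (1 + t)^-1) = 0 by field; rewrite gt_eqF.
rewrite scale0r addr0 => /(ler_wpM2l (ltW t10)).
have -> : (1 + t) * ((1 + t)^-1 * F (x + t *: h) +
   (1 - (1 + t)^-1) * F (x - h)) = F (x + t *: h) + t * F (x - h).
  by field; rewrite gt_eqF.
lra.
Qed.

Let D_le t h : 0 < t -> D h <= q t h.
Proof.
move=> t0; apply: ge_inf; last by exists t.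
by exists (F x - F (x - h)) => _ [s s0 <-]; exact: q_ge.
Qed.

Let D_ge m h : (forall t, 0 < t -> m <= q t h) -> m <= D h.
Proof.
move=> hm; apply: lb_le_inf; last by move=> _ [s s0 <-]; exact: hm.
by exists (q 1 h), 1; rewrite //= ltr01.
Qed.

(** The point [x + r *: (h + k)] lies on the segment from [x + t *: h] to
    [x + s *: k] exactly when [r = t * s / (s + t)], the weights being
    [s / (s + t)] and [t / (s + t)]. *)
Let q_add t s h k : 0 < t -> 0 < s ->
  q (t * s / (s + t)) (h + k) <= q t h + q s k.
Proof.
move=> t0 s0; have st0 : 0 < s + t by lra.
have l0 : 0 <= s / (s + t) by rewrite divr_ge0// ltW.
have l1 : s / (s + t) <= 1 by rewrite ler_pdivrMr//; lra.
have := @convexf_at _ _ F x (t *: h) (s *: k) _ cF l0 l1.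
have -> : (s / (s + t)) *: (t *: h) + (1 - s / (s + t)) *: (s *: k) =
    (t * s / (s + t)) *: (h + k).
  by rewrite !scalerA scalerDr; congr (_ *: _ + _ *: _); field; rewrite gt_eqF.
rewrite /q; have r0 : 0 < t * s / (s + t) by rewrite divr_gt0// mulr_gt0.
move=> H; rewrite ler_pdivrMr//.
have -> : ((F (x + t *: h) - F x) / t + (F (x + s *: k) - F x) / s) *
  (t * s / (s + t)) = s / (s + t) * F (x + t *: h) +
    (1 - s / (s + t)) * F (x + s *: k) - F x.
  by field; rewrite !gt_eqF.
lra.
Qed.

Let D_sub h k : D (h + k) <= D h + D k.
Proof.
rewrite -lerBlDr; apply: D_ge => t t0.
rewrite lerBlDr -lerBlDl; apply: D_ge => s s0.
rewrite lerBlDl; apply: (le_trans _ (q_add h k t0 s0)).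
by apply: D_le; rewrite divr_gt0 ?mulr_gt0 ?addr_gt0.
Qed.

Let D0 : D 0 = 0.
Proof.
have q0 t : q t 0 = 0 by rewrite /q scaler0 addr0 subrr mul0r.
apply/eqP; rewrite eq_le; apply/andP; split.
  by rewrite -(q0 1); apply: D_le; exact: ltr01.
by apply: D_ge => t _; rewrite q0.
Qed.

(** [q t h + q t (- h)] is the second difference divided by [t], which tends to
    zero with [t]. *)
Let D_oppr h : D h + D (- h) <= 0.
Proof.
apply/ler_addgt0Pl => e e0; rewrite addr0.
have K0 : 0 <= c * N h `^ (1 + alpha) by rewrite mulr_ge0// powR_ge0.
have [t t0 /(_ t (ltW t0) (lexx _)) ht] := powR_superlinear alpha0 K0 e0.
apply: (le_trans (lerD (D_le h t0) (D_le (- h) t0))).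
rewrite /q -mulrDl ler_pdivrMr//.
apply: le_trans _ ht.
have := F2 (t *: h).
rewrite eqnormZ// gtr0_norm// powRM ?eqnorm_ge0// ?(ltW t0)// scalerN.
lra.
Qed.

Let DN h : D (- h) = - D h.
Proof. by have := D_sub h (- h); have := D_oppr h; rewrite subrr D0; lra. Qed.

Let DD h k : D (h + k) = D h + D k.
Proof.
have h1 := D_sub h k; have := D_sub (h + k) (- k).
by rewrite addrK DN; lra.
Qed.

Let D_scale_le a h : 0 < a -> D (a *: h) <= a * D h.
Proof.
move=> a0; rewrite mulrC -ler_pdivrMr//; apply: D_ge => s s0.
rewrite ler_pdivrMr//; have sa0 : 0 < s / a by rewrite divr_gt0.
apply: (le_trans (D_le _ sa0)).
rewrite /q scalerA divfK ?gt_eqF// le_eqVlt; apply/orP; left; apply/eqP.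
by field; rewrite !gt_eqF.
Qed.

Let DZ a h : D (a *: h) = a * D h.
Proof.
have pos b k : 0 < b -> D (b *: k) = b * D k.
  move=> b0; apply/eqP; rewrite eq_le D_scale_le//=.
  rewrite mulrC -ler_pdivlMr// mulrC.
  have := @D_scale_le b^-1 (b *: k); rewrite invr_gt0 => /(_ b0).
  by rewrite scalerA mulVf ?gt_eqF// scale1r.
have [a0|a0|->] := ltgtP a 0.
- have na0 : 0 < - a by rewrite oppr_gt0.
  by have := pos (- a) h na0; rewrite scaleNr DN mulNr => /oppr_inj.
- exact: pos.
- by rewrite scale0r D0 mul0r.
Qed.

(** The directional derivative is the gradient: it is subadditive and odd, hence
    linear, and it lies below the increments of [F], hence is continuous.
    Adding [D (- h) <= F (x - h) - F x] to the bound on the second difference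
    gives the upper estimate. *)
Lemma convexf_gradient (B : R) : (forall h, N h <= 1 -> F (x + h) <= B) ->
  exists L : X -> R, dual X L /\ forall h,
    0 <= F (x + h) - F x - L h /\
    F (x + h) - F x - L h <= c * N h `^ (1 + alpha).
Proof.
move=> hB; exists D.
have Dle h : D h <= F (x + h) - F x.
  by have := D_le h ltr01; rewrite /q scale1r divr1.
split; last first.
  move=> h; have := Dle h; have := Dle (- h); rewrite DN; have := F2 h.
  by split; lra.
split; first by move=> a u v; rewrite DD DZ.
move=> y; apply: (continuous_eqnorm hN (K := B - F x)) => h h1.
rewrite DD addrAC subrr add0r.
have lip k : N k <= 1 -> D k <= (B - F x) * N k.
  move=> k1; apply: (le_trans (Dle k)); apply: (le_trans (ler_norm _)).
  exact: convexf_ball_lipschitz.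
rewrite ler_norml; apply/andP; split; last exact: lip.
by have := lip (- h); rewrite eqnormN// DN => /(_ h1); lra.
Qed.

End Gradient.

(** A first-order expansion determines the derivative, so this yields both
    differentiability everywhere and the value of the derivative on [E]. *)
Lemma expansion_differentiable (F L : X -> R) (x : X) (alpha c : R) :
  0 < alpha -> 0 <= c -> dual X L ->
  (forall h, `|F (x + h) - F x - L h| <= c * N h `^ (1 + alpha)) ->
  differentiable F x /\ ('d F x : X -> R) = L.
Proof.
move=> alpha0 c0 dL hF; have [l lE] := dual_pack dL.
have [_ [a [b [a0 b0 ab]]]] := hN.
have lc : continuous l by rewrite lE; exact: dL.2.
have exp : (F : X -> R^o) \o shift x = cst (F x) + l +o_ (0 : X) id.
  apply/eqaddoP => e e0.
  have eb0 : 0 < e / b by rewrite divr_gt0.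
  have [t t0 ht] := powR_superlinear alpha0 c0 eb0.
  near=> h; have Nht : N h <= t.
    by apply: ltW; near: h; exact: eqnorm_lt_near.
  rewrite /= !fctE /= lE [h + x]addrC opprD addrA.
  apply: (le_trans (hF h)); apply: (le_trans (ht _ (eqnorm_ge0 hN h) Nht)).
  by rewrite -mulrA ler_pM2l// mulrC ler_pdivrMr// mulrC; exact: (ab h).2.
have dE := diff_unique lc exp.
split; last by rewrite -lE.
by apply/diff_locallyP; rewrite dE.
Unshelve. all: by end_near. Qed.

(** Evaluate [F] at [y + k] in two ways: from below by the tangent at [x], from
    above by the expansion at [y].  With the expansion of [F y] at [x] this
    gives
    [L x k - L y k <= c * d ^ (1 + alpha) + c * N k ^ (1 + alpha)] for
    [d = N (x - y)]; the choice [N k <= d] turns it into a bound of the dual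
    norm. *)
Lemma gradient_holder (F : X -> R) (L : X -> X -> R) (alpha c : R) :
  0 < alpha -> 0 <= c -> (forall x, dual X (L x)) ->
  (forall x h, 0 <= F (x + h) - F x - L x h /\
     F (x + h) - F x - L x h <= c * N h `^ (1 + alpha)) ->
  forall x y, x <> y ->
    dual_norm N (fun h => L x h - L y h) <= 2 * c * N (x - y) `^ alpha.
Proof.
move=> alpha0 c0 dL hF x y xy.
have add z u v : L z (u + v) = L z u + L z v.
  by have := (dL z).1 1 u v; rewrite scale1r mul1r.
have scale z a u : L z (a *: u) = a * L z u.
  have [l <-] := dual_pack (dL z); exact: linearZ.
set d := N (x - y).
have d0 : 0 < d.
  rewrite lt_neqAle eqnorm_ge0// andbT; apply/negP => /eqP/esym.
  by move/(eqnorm_eq0 hN)/subr0_eq.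
have one h : N h <= 1 -> L x h - L y h <= 2 * c * d `^ alpha.
  move=> h1; have Nk : N (d *: h) <= d.
    by rewrite eqnormZ// gtr0_norm// -[leRHS]mulr1 ler_pM2l.
  have Nkp : c * N (d *: h) `^ (1 + alpha) <= c * (d * d `^ alpha).
    rewrite -powR_1D ?(ltW alpha0) ?(ltW d0)//; apply: ler_wpM2l => //.
    have p0 : 0 <= 1 + alpha by lra.
    by apply: ge0_ler_powR; rewrite ?nnegrE ?(eqnorm_ge0 hN) ?(ltW d0).
  have [_ H1] := hF y (d *: h).
  have [H2 _] := hF x ((y - x) + d *: h).
  have [_ H3] := hF x (y - x).
  move: H2 H3; rewrite addrA [x + (y - x)]addrC subrK add.
  have -> : N (y - x) = d by rewrite -opprB (eqnormN hN).
  rewrite (powR_1D (ltW alpha0) (ltW d0)) => H2 H3.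
  rewrite -(ler_pM2l d0) mulrBr -!scale.
  lra.
apply: (dual_norm_le hN) => h h1; rewrite ler_norml one// andbT.
have := one (- h); rewrite eqnormN// => /(_ h1).
by rewrite -scaleN1r !scale; lra.
Qed.

End ConvexRegularity.

(** * The convex envelope *)

Section ConvexEnvelope.
Context {R : realType} {X : normedModType R}.
Implicit Types (g phi F : X -> R).

Lemma le_conv_env g phi : convexf phi -> continuous phi ->
  (forall x, phi x <= g x) -> forall x, ((phi x)%:E <= conv_env g x)%E.
Proof.
move=> cphi ctphi phig x; apply: le_ereal_sup_tmp.
exists (phi x)%:E => //=; exists (fun z => (phi z)%:E) => //; split.
- by move=> u v t t0 t1; rewrite -!EFinM -EFinD lee_fin; exact: cphi.
- by split=> [z|]; [rewrite ltNyr | exists 0; rewrite ltry].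
- move=> z r; rewrite lte_fin => rz.
  exists [set w | r < phi w]; last by move=> w /=; rewrite lte_fin.
  exact: (@cvgr_gt R X (nbhs z) _ phi (phi z) (ctphi z) r rz).
- by move=> z; rewrite lee_fin.
Qed.

(** A convex continuous minorant [a] excludes the value [-oo], and [g] excludes
    [+oo].  The last clause is the form in which the maximality of the envelope
    is applied, to tangents and to averaged translates. *)
Lemma conv_env_finite g a : convexf a -> continuous a ->
  (forall x, a x <= g x) ->
  exists F, [/\ forall x, (F x)%:E = conv_env g x, convexf F,
    forall x, F x <= g x &
    forall phi, convexf phi -> continuous phi -> (forall x, phi x <= g x) ->
      forall x, phi x <= F x].
Proof.
move=> ca cta ag.
have le_g x : (conv_env g x <= (g x)%:E)%E.
  by apply: ge_ereal_sup => _ [phi [_ _ _ phig] <-]; exact: phig.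
have FE x : (fine (conv_env g x))%:E = conv_env g x.
  apply: fineK; rewrite fin_numE; apply/andP; split.
    by apply: contraTneq (le_conv_env ca cta ag x) => ->.
  by apply: contraTneq (le_g x) => ->.
exists (fun x => fine (conv_env g x)); split => //.
- move=> x y t t0 t1; rewrite -lee_fin FE EFinD !EFinM !FE.
  apply: ge_ereal_sup => _ [phi [cphi pphi lphi phig] <-].
  have ub z : (phi z <= conv_env g z)%E.
    by apply: le_ereal_sup_tmp; exists (phi z) => //; exists phi.
  apply: (le_trans (cphi x y t t0 t1)).
  by apply: leeD; apply: lee_wpmul2l; rewrite ?lee_fin ?subr_ge0.
- by move=> x; rewrite -lee_fin FE.
- by move=> phi cphi ctphi phig x; rewrite -lee_fin FE; exact: le_conv_env.
Qed.

(** For each [h] the function [phi = (F (_ + h) + F (_ - h) - w h) / 2] is a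
    competitor in the definition of the envelope: it is convex and continuous
    like [F], and below [g] because [F] is and because of the hypothesis on [g].
    So [phi <= F], which is the claim. *)
Lemma envelope_second_difference g F (w : X -> R) : convexf F ->
  continuous F -> (forall x, F x <= g x) ->
  (forall phi, convexf phi -> continuous phi -> (forall x, phi x <= g x) ->
     forall x, phi x <= F x) ->
  (forall x h, g (x + h) + g (x - h) - 2 * g x <= w h) ->
  forall x h, F (x + h) + F (x - h) - 2 * F x <= w h.
Proof.
move=> cF ctF Fg Fmax hg x h.
have ctS k : continuous (fun z => F (z + k)).
  move=> z; apply: (@continuous_comp _ _ _ (fun z => z + k) F).
    by apply: cvgD; [exact: cvg_id | exact: cvg_cst].
  exact: ctF.
pose phi z := 2^-1 * (F (z + h) + F (z - h) - w h).
suff : phi x <= F x by rewrite /phi; lra.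
apply: Fmax.
- move=> u v t t0 t1.
  have := cF (u + h) (v + h) t t0 t1; have := cF (u - h) (v - h) t t0 t1.
  by rewrite -!convex_comb_shift /phi; lra.
- move=> z; apply: (@cvgM R X (nbhs z)); first exact: cvg_cst.
  apply: (@cvgB _ R^o); last exact: cvg_cst.
  by apply: (@cvgD _ R^o); exact: ctS.
- move=> z; rewrite /phi; have := hg z h.
  by have := Fg (z + h); have := Fg (z - h); lra.
Qed.

Lemma affine_convexf (l : X -> R) (b : R) (y : X) : dual X l ->
  convexf (fun x => b + l (x - y)).
Proof.
move=> dl u v t t0 t1; have [L <-] := dual_pack dl.
rewrite convex_comb_shift linearD !linearZ /= le_eqVlt.
apply/orP; left; apply/eqP.
by rewrite /GRing.scale /=; ring.
Qed.

Lemma affine_continuous (l : X -> R) (b : R) (y : X) : dual X l ->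
  continuous (fun x => b + l (x - y)).
Proof.
move=> dl x; apply: (@cvgD _ R^o); first exact: cvg_cst.
apply: (@continuous_comp _ _ _ (fun z => z - y) l).
  by apply: cvgB; [exact: cvg_id | exact: cvg_cst].
exact: dl.2.
Qed.

End ConvexEnvelope.

(** * Infimum of the growth bounds prescribed by the jets *)

Definition jet_bound (R : realType) (X : normedModType R) (N : X -> R)
    (alpha M : R) (f : X -> R) (G : X -> X -> R) (x y : X) : R :=
  f y + G y (x - y) + M / (1 + alpha) * N (x - y) `^ (1 + alpha).

Section CWJets.
Context {R : realType} {X : normedModType R} {N : X -> R}.
Hypothesis hN : equivalent_norm N.
Context {alpha M : R} {E : set X} {f : X -> R} {G : X -> X -> R}.
Hypotheses (alpha0 : 0 < alpha) (M0 : 0 < M).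
Hypothesis hG : forall y, E y -> dual X (G y).

(** By [CW] at [y] and [z], the difference of the two sides is at least
    [(G y - G z) (x - y)] plus the two terms of [young_weighted] with
    [a = dual_norm N (G y - G z)] and [b = N (x - y)]. *)
Lemma CW_tangent_le_jet_bound x y z : CW N alpha M E f G -> E y -> E z ->
  f z + G z (x - z) <= jet_bound N alpha M f G x y.
Proof.
move=> hCW Ey Ez; have := hCW y z Ey Ez; rewrite /jet_bound.
have dB := dualB (hG Ey) (hG Ez).
have := young_weighted alpha0 M0 (dual_norm_ge0 hN dB) (eqnorm_ge0 hN (x - y)).
have := dual_eqnorm_le hN (x - y) dB; rewrite ler_norml => /andP[+ _].
have -> : x - z = (x - y) + (y - z) by rewrite addrA subrK.
have [L <-] := dual_pack (hG Ez); rewrite linearD; lra.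
Qed.

Lemma jet_bound_self x : E x -> jet_bound N alpha M f G x x = f x.
Proof.
move=> Ex; have p0 : 1 + alpha != 0 by rewrite gt_eqF// addr_gt0.
rewrite /jet_bound subrr (eqnorm0 hN) powR0//.
by have [L <-] := dual_pack (hG Ex); rewrite linear0; lra.
Qed.

Lemma CW_infimum : E !=set0 -> CW N alpha M E f G ->
  exists g : X -> R,
    [/\ forall x, (g x)%:E =
          ereal_inf [set (jet_bound N alpha M f G x y)%:E | y in E],
        forall x z, E z -> f z + G z (x - z) <= g x,
        forall x y, E y -> g x <= jet_bound N alpha M f G x y &
        forall x m, (forall y, E y -> m <= jet_bound N alpha M f G x y) ->
          m <= g x].
Proof.
move=> [y0 Ey0] hCW; pose S x := [set jet_bound N alpha M f G x y | y in E].
have S0 x : S x !=set0 by exists (jet_bound N alpha M f G x y0), y0.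
have lbS x : has_lbound (S x).
  exists (f y0 + G y0 (x - y0)) => _ [y Ey <-].
  exact: CW_tangent_le_jet_bound.
exists (fun x => inf (S x)); split.
- by move=> x; rewrite -ereal_inf_EFin//; congr ereal_inf; rewrite image_comp.
- move=> x z Ez; apply: lb_le_inf => // _ [y Ey <-].
  exact: CW_tangent_le_jet_bound.
- by move=> x y Ey; apply: ge_inf => //; exists y.
- by move=> x m hm; apply: lb_le_inf => // _ [y Ey <-]; exact: hm.
Qed.

End CWJets.

(** For each [y] the affine part of the growth bound has no second difference,
    so that the smoothness of the norm applies at [x - y]; then take the infimum
    over [y] on the side of [g x]. *)
Lemma infimum_second_difference (R : realType) (X : normedModType R)
    (N : X -> R) (alpha C M : R) (E : set X) (f : X -> R) (G : X -> X -> R)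
    (g : X -> R) : 0 < alpha -> 0 < M ->
  (forall y, E y -> dual X (G y)) ->
  (forall x h : X, N (x + h) `^ (1 + alpha) + N (x - h) `^ (1 + alpha)
     - 2 * N x `^ (1 + alpha) <= C * N h `^ (1 + alpha)) ->
  (forall x y, E y -> g x <= jet_bound N alpha M f G x y) ->
  (forall x m, (forall y, E y -> m <= jet_bound N alpha M f G x y) ->
     m <= g x) ->
  forall x h, g (x + h) + g (x - h) - 2 * g x
    <= M / (1 + alpha) * C * N h `^ (1 + alpha).
Proof.
move=> alpha0 M0 hG hs gle gmax x h.
suff : 2^-1 * (g (x + h) + g (x - h) - M / (1 + alpha) * C * N h `^ (1 + alpha))
    <= g x by lra.
apply: gmax => y Ey; have := gle (x + h) y Ey; have := gle (x - h) y Ey.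
rewrite /jet_bound ![x + _ - y]addrAC.
have [L <-] := dual_pack (hG y Ey); rewrite linearB linearD /=.
have Mp : 0 <= M / (1 + alpha) by rewrite divr_ge0; lra.
have := ler_wpM2l Mp (hs (x - y) h).
move: (M / (1 + alpha)) (N _ `^ _) (N (_ - h) `^ _) (N h `^ _) => *; lra.
Qed.

Lemma jet_bound_ball_bounded (R : realType) (X : normedModType R)
    (N : X -> R) (hN : equivalent_norm N) (alpha M : R) (f : X -> R)
    (G : X -> X -> R) (x y : X) :
  0 < alpha -> 0 < M -> dual X (G y) ->
  exists B, forall h, N h <= 1 -> jet_bound N alpha M f G (x + h) y <= B.
Proof.
move=> alpha0 M0 dG; have [K K0 hK] := dual_bounded hN dG.
exists (f y + (G y (x - y) + K)
  + M / (1 + alpha) * (N (x - y) + 1) `^ (1 + alpha)) => h h1.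
have Mp : 0 <= M / (1 + alpha) by rewrite divr_ge0; lra.
rewrite /jet_bound [x + h - y]addrAC; apply: lerD; last first.
  have Nle : N (x - y + h) <= N (x - y) + 1.
    by apply: (le_trans (eqnormD hN _ _)); rewrite lerD2l.
  have p0 : 0 <= 1 + alpha by lra.
  apply: ler_wpM2l => //; apply: ge0_ler_powR => //; rewrite nnegrE.
    exact: eqnorm_ge0.
  by apply: addr_ge0 => //; exact: eqnorm_ge0.
rewrite lerD2l; have [L LE] := dual_pack dG; rewrite -LE linearD lerD2l.
rewrite LE; apply: (le_trans (ler_norm _)); apply: (le_trans (hK h)).
by rewrite -[leRHS]mulr1 ler_wpM2l.
Qed.

(** * The extension theorem *)

Theorem theorem5p5 (R : realType) (X : completeNormedModType R)
    (hX : superreflexive X)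
    (N : X -> R) (hN : equivalent_norm N)
    (alpha C : R) (halpha0 : 0 < alpha) (halpha1 : alpha <= 1) (hC : 2 <= C)
    (hsmooth : forall x h : X,
       N (x + h) `^ (1 + alpha) + N (x - h) `^ (1 + alpha)
         - 2 * N x `^ (1 + alpha) <= C * N h `^ (1 + alpha))
    (E : set X) (hE : E !=set0)
    (f : X -> R) (G : X -> X -> R) (hG : forall y, E y -> dual X (G y))
    (M : R) (hM : 0 < M) (hCW : CW N alpha M E f G) :
  exists g F : X -> R,
    (forall x, (g x)%:E = ereal_inf
       [set (f y + G y (x - y)
              + M / (1 + alpha) * N (x - y) `^ (1 + alpha))%:E | y in E])
    /\ (forall x, (F x)%:E = conv_env g x)
    /\ class_C1 N alpha F
    /\ convex_function (setT : set (convex_lmodType X)) F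
    /\ (forall x, E x -> F x = f x)
    /\ (forall x, E x -> ('d F x : X -> R) = G x)
    /\ (holder_const N alpha setT (fun x => 'd F x : X -> R)
          <= (2 `^ (1 + alpha) * C / (1 + alpha) * M)%:E)%E.
Proof.
have [g [gE g_tan g_jet g_max]] := CW_infimum hN halpha0 hM hG hE hCW.
have [y0 Ey0] := hE; have dG0 := hG y0 Ey0.
have tan_le z : E z -> forall x, f z + G z (x - z) <= g x.
  by move=> Ez x; exact: g_tan.
have tan_cvx z : E z -> convexf (fun x => f z + G z (x - z)).
  by move=> /hG; exact: affine_convexf.
have tan_ct z : E z -> continuous (fun x => f z + G z (x - z)).
  by move=> /hG; exact: affine_continuous.
have [F [FE cF Fg Fmax]] := conv_env_finite
  (tan_cvx y0 Ey0) (tan_ct y0 Ey0) (tan_le y0 Ey0).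
have F_tan z x : E z -> f z + G z (x - z) <= F x.
  by move=> Ez; exact: (Fmax _ (tan_cvx z Ez) (tan_ct z Ez) (tan_le z Ez)).
have F_jet x y : E y -> F x <= jet_bound N alpha M f G x y.
  by move=> Ey; apply: (le_trans (Fg x)); exact: g_jet.
have F_bounded x : exists B, forall h, N h <= 1 -> F (x + h) <= B.
  have [B hB] := jet_bound_ball_bounded hN f x halpha0 hM dG0.
  by exists B => h h1; apply: (le_trans (F_jet _ y0 Ey0)); exact: hB.
have ctF := convexf_continuous hN cF F_bounded.
have Mp : 0 <= M / (1 + alpha) by rewrite divr_ge0; lra.
set c := M / (1 + alpha) * C.
have c0 : 0 <= c by rewrite mulr_ge0//; lra.
have F2 := envelope_second_difference cF ctF Fg Fmax
  (infimum_second_difference halpha0 hM hG hsmooth g_jet g_max).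
have grad x : exists L : X -> R, dual X L /\ forall h,
    0 <= F (x + h) - F x - L h /\
    F (x + h) - F x - L h <= c * N h `^ (1 + alpha).
  have [B hB] := F_bounded x.
  exact: (convexf_gradient hN cF halpha0 c0 (F2 x) hB).
have [L hL] := choice grad.
have dF x : differentiable F x /\ ('d F x : X -> R) = L x.
  have [dL exL] := hL x; apply: (expansion_differentiable hN halpha0 c0 dL).
  by move=> h; have [lo up] := exL h; rewrite ger0_norm.
have F_E x : E x -> F x = f x.
  move=> Ex; apply/eqP; rewrite eq_le; apply/andP; split.
    by rewrite -[leRHS](jet_bound_self hN (M := M) halpha0 hG Ex); exact: F_jet.
  have := F_tan x x Ex; rewrite subrr.
  by have [l <-] := dual_pack (hG x Ex); rewrite linear0 addr0.
have holder : (holder_const N alpha setT (fun x => 'd F x : X -> R)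
    <= (2 `^ (1 + alpha) * C / (1 + alpha) * M)%:E)%E.
  apply: ge_ereal_sup => _ [[x y] /= [_ _ xy] <-].
  rewrite (dF x).2 (dF y).2 lee_fin.
  have Nxy : 0 < N (x - y).
    rewrite lt_neqAle eqnorm_ge0// andbT; apply/negP => /eqP/esym.
    by move/(eqnorm_eq0 hN)/subr0_eq.
  rewrite ler_pdivrMr ?powR_gt0//.
  apply: (le_trans (gradient_holder hN halpha0 c0 (fun x => (hL x).1)
    (fun x => (hL x).2) xy)).
  apply: ler_wpM2r; first exact: powR_ge0.
  have -> : 2 `^ (1 + alpha) * C / (1 + alpha) * M = 2 `^ (1 + alpha) * c.
    by rewrite /c; ring.
  apply: ler_wpM2r => //; rewrite -[leLHS]powRr1//.
  by apply: ler_powR; lra.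
exists g, F; split; first exact: gE.
split; first exact: FE.
split; [|split; [|split; [|split]]].
- split; first by move=> x; exact: (dF x).1.
  exact: (le_lt_trans holder (ltry _)).
- move=> t x y _ _; rewrite convRE.
  by apply: cF; [exact: ge0 | exact: le1].
- exact: F_E.
- move=> x Ex; have exG h : `|F (x + h) - F x - G x h|
      <= M / (1 + alpha) * N h `^ (1 + alpha).
    have := F_tan x (x + h) Ex; have := F_jet (x + h) x Ex.
    rewrite /jet_bound [x + h]addrC addrK -(F_E x Ex) => up lo.
    by rewrite ger0_norm; lra.
  exact: (expansion_differentiable hN halpha0 Mp (hG x Ex) exG).2.
- exact: holder.
Qed.
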